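(* For every even positive integer $n$, there are infinitely many integral trees of diameter $2n+1$.
   Context: A graph is integral if all eigenvalues of its adjacency matrix are integers. *)

(* Defs.v *)
From mathcomp Require Import all_boot all_order all_algebra all_field.
Set Implicit Arguments. Unset Strict Implicit. Unset Printing Implicit Defensive.
Import Order.TTheory GRing.Theory Num.Theory.

Definition simple_graph (N : nat) (e : rel 'I_N) : Prop :=
  (forall x y, e x y = e y x) /\ (forall x, ~~ e x x).

Definition connected_graph (N : nat) (e : rel 'I_N) : Prop :=
  forall x y, connect e x y.

Definition acyclic_graph (N : nat) (e : rel 'I_N) : Prop :=
  forall c : seq 'I_N, 3 <= size c -> uniq c -> ~~ cycle e c.

Definition is_tree (N : nat) (e : rel 'I_N) : Prop :=
  0 < N /\ simple_graph e /\ connected_graph e /\ acyclic_graph e.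

Definition dist_le (N : nat) (e : rel 'I_N) (x y : 'I_N) (k : nat) : Prop :=
  exists p : seq 'I_N, [/\ path e x p, last x p = y & size p <= k].

Definition has_diameter (N : nat) (e : rel 'I_N) (d : nat) : Prop :=
  (forall x y, dist_le e x y d) /\
  (exists x y, forall k, dist_le e x y k -> d <= k).

Definition adj_mx (N : nat) (e : rel 'I_N) : 'M[algC]_N :=
  \matrix_(i, j) ((e i j)%:R)%R.

Definition integral_graph (N : nat) (e : rel 'I_N) : Prop :=
  forall a : algC, eigenvalue (adj_mx e) a -> a \is a Num.int.

(* Main.v *)
(** For a rooted tree T and a non-integer l, the equations of an eigenvector y of
    T at all vertices, with an extra parent of value z attached to the root, force
    D_T * y(root) = z, where D_T depends only on l.  Grafting the root of U below
    the root of T gives D_T - 1 / D_U, and l is an eigenvalue only if D_T = 0.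

    Csikvari's trees C_k(s_1 < ... < s_k), of height k, satisfy
    D_k * D_(k-1) = l^2 - s_k.  So the tree obtained by adding M + 1 copies of C_n
    below the root of C_(n-1)(s_1, ..., s_(n-1)) is integral when all s_i and
    s_n + M + 1 are squares, but its diameter is even.  For n even,
      s_2 / D_n(s_1, ..., s_n)
        = (s_2 - s_1) / D_(n-1)(s_2, ..., s_n) + s_1 / D_(n-2)(s_3, ..., s_n),
    so, when M = s_2 q, all copies but one can be traded for copies of shorter
    trees without changing D.  The remaining C_n is joined by an edge to a tree
    of height n, whence the diameter 2n + 1.  With s_i = i^2 and M = 4 q this
    needs n^2 + 4 q + 1 to be a square, which holds for infinitely many q. *)

Require Import Defs.
From mathcomp Require Import all_boot all_order all_algebra all_field.
From mathcomp Require Import zify ring.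
Set Implicit Arguments. Unset Strict Implicit. Unset Printing Implicit Defensive.
Import Order.TTheory GRing.Theory Num.Theory.

(** * Rooted trees built by grafting *)

Inductive rtree := Vtx | Graft of rtree & rtree.

Fixpoint vert (t : rtree) : finType :=
  if t is Graft T U then (vert T + vert U)%type else unit.

Fixpoint root (t : rtree) : vert t :=
  if t is Graft T U return vert t then inl (root T) else tt.

Fixpoint adj (t : rtree) : rel (vert t) :=
  match t return rel (vert t) with
  | Vtx => fun _ _ => false
  | Graft T U => fun x y =>
      match x, y with
      | inl a, inl b => adj a b
      | inr a, inr b => adj a b
      | inl a, inr b | inr b, inl a => (a == root T) && (b == root U)
      end
  end.

Fixpoint depth (t : rtree) : vert t -> nat :=
  match t return vert t -> nat with
  | Vtx => fun=> 0
  | Graft T U => fun x =>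
      match x with inl a => depth a | inr b => (depth b).+1 end
  end.

Fixpoint height (t : rtree) : nat :=
  if t is Graft T U then maxn (height T) (height U).+1 else 0.

Lemma adj_sym t : symmetric (@adj t).
Proof. by elim: t => //= T IT U IU [a|a] [b|b] /=. Qed.

Lemma adj_irrefl t : irreflexive (@adj t).
Proof. by elim: t => //= T IT U IU [a|a] /=. Qed.

Lemma depth_root t : depth (root t) = 0.
Proof. by elim: t. Qed.

Lemma depth_adj t (x y : vert t) :
  adj x y -> depth x = (depth y).+1 \/ depth y = (depth x).+1.
Proof.
elim: t x y => //= T IT U IU [a|a] [b|b] /=.
- exact: IT.
- by case/andP=> /eqP-> /eqP->; rewrite !depth_root; right.
- by case/andP=> /eqP-> /eqP->; rewrite !depth_root; left.
- by case/IU=> ->; [left|right].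
Qed.

(** Induction leaves only the grafting edge to check. It gives the root of [U] its parent, and that
    root, having depth 0 in [U], has no shallower neighbour there. *)
Lemma parent_unique t (x y z : vert t) :
  adj x y -> adj x z -> depth y < depth x -> depth z < depth x -> y = z.
Proof.
elim: t x y z => //= T IT U IU [a|a] [b|b] [c|c] //=.
- by move=> H1 H2 H3 H4; congr inl; apply: IT H1 H2 H3 H4.
- by move=> _ /andP[/eqP-> _]; rewrite depth_root.
- by case/andP=> /eqP-> _; rewrite depth_root.
- by case/andP=> /eqP-> _; rewrite depth_root.
- by case/andP=> /eqP-> _ /andP[/eqP-> _].
- by case/andP=> _ /eqP->; rewrite depth_root.
- by move=> _ /andP[_ /eqP->]; rewrite depth_root.
- by rewrite !ltnS => H1 H2 H3 H4; congr inr; apply: IU H1 H2 H3 H4.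
Qed.

Lemma depth_le_height t (x : vert t) : depth x <= height t.
Proof.
elim: t x => //= T IT U IU [a|b] /=; rewrite leq_max ?IT //.
by rewrite ltnS IU orbT.
Qed.

Lemma height_attained t : exists x : vert t, depth x = height t.
Proof.
elim: t => [|T [a ha] U [b hb]] /=; first by exists tt.
case: (leqP (height T) (height U).+1) => h.
- by exists (inr b); rewrite /= hb.
- by exists (inl a); rewrite /= ha.
Qed.

(** * Walks and distances in a grafted tree *)

Definition reach t (x y : vert t) (k : nat) : Prop :=
  exists p, [/\ path (@adj t) x p, last x p = y & size p <= k].

Lemma reach_sym t (x y : vert t) k : reach x y k -> reach y x k.
Proof.
case=> p [hp <- hs]; exists (rev (belast x p)); split.
- by rewrite rev_path (eq_path (e' := @adj t)) // => a b; rewrite adj_sym.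
- by case: p {hp hs} => //= a p; rewrite rev_cons last_rcons.
- by rewrite size_rev size_belast.
Qed.

Lemma reach_trans t (x y z : vert t) j k :
  reach x y j -> reach y z k -> reach x z (j + k).
Proof.
case=> p [hp <- hs] [q [hq <- hs']]; exists (p ++ q).
by rewrite cat_path hp hq last_cat size_cat leq_add.
Qed.

Lemma reach_weaken t (x y : vert t) j k : j <= k -> reach x y j -> reach x y k.
Proof. by move=> hjk [p [? ? hs]]; exists p; split=> //; apply: leq_trans hjk. Qed.

Lemma reach_inl T U (x y : vert T) k :
  reach x y k -> @reach (Graft T U) (inl x) (inl y) k.
Proof.
case=> p [hp <- hs]; exists (map inl p).
by rewrite size_map last_map path_map.
Qed.

Lemma reach_inr T U (x y : vert U) k :
  reach x y k -> @reach (Graft T U) (inr x) (inr y) k.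
Proof.
case=> p [hp <- hs]; exists (map inr p).
by rewrite size_map last_map path_map.
Qed.

Lemma reach_graft T U : @reach (Graft T U) (inl (root T)) (inr (root U)) 1.
Proof. by exists [:: inr (root U)]; split=> //=; rewrite !eqxx. Qed.

Lemma reach_root t (x : vert t) : reach (root t) x (depth x).
Proof.
elim: t x => [[]|T IT U IU [a|b]]; first by exists [::].
- exact: reach_inl.
- exact: reach_trans (reach_graft T U) (reach_inr T (IU b)).
Qed.

Lemma reach_le t (x y : vert t) : reach x y (depth x + depth y).
Proof. exact: reach_trans (reach_sym (reach_root x)) (reach_root y). Qed.

(** Two vertices on the same side are joined through the root of that side, in at most 2n steps;
    only a change of side costs the extra edge. *)
Lemma reach_graft_le T U n : height T <= n -> height U <= n ->
  forall x y : vert (Graft T U), reach x y (2 * n + 1).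
Proof.
move=> hT hU [a|a] [b|b].
- have := reach_le a b => /(@reach_inl T U); apply: reach_weaken.
  by have := depth_le_height a; have := depth_le_height b; lia.
- have := @reach_le (Graft T U) (inl a) (inr b); apply: reach_weaken => /=.
  by have := depth_le_height a; have := depth_le_height b; lia.
- have := @reach_le (Graft T U) (inr a) (inl b); apply: reach_weaken => /=.
  by have := depth_le_height a; have := depth_le_height b; lia.
- have := reach_le a b => /(@reach_inr T U); apply: reach_weaken.
  by have := depth_le_height a; have := depth_le_height b; lia.
Qed.

(* The signed depth (negative on T, positive on U) changes by at most one along
   an edge. *)
Lemma reach_graft_ge T U (a : vert T) (b : vert U) k :
  @reach (Graft T U) (inl a) (inr b) k -> depth a + (depth b).+1 <= k.
Proof.
pose pot (x : vert (Graft T U)) : int :=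
  match x with inl a => (- (depth a)%:Z)%R | inr b => (depth b).+1%:Z%R end.
have pot_adj x y : @adj (Graft T U) x y -> (pot y <= pot x + 1)%R.
  case: x y => [x|x] [y|y] /=; rewrite /pot.
  - by move=> /depth_adj; lia.
  - by case/andP=> /eqP-> /eqP->; rewrite !depth_root.
  - by case/andP=> /eqP-> /eqP->; rewrite !depth_root.
  - by move=> /depth_adj; lia.
have pot_path x p : path (@adj (Graft T U)) x p ->
    (pot (last x p) <= pot x + (size p)%:Z)%R.
  elim: p x => [|y p IH] x; first by rewrite addr0.
  move=> /andP[/pot_adj h1 /IH h2].
  by change (pot (last y p) <= pot x + (size p).+1%:Z)%R; lia.
case=> p [/pot_path h hl hs]; move: h; rewrite hl /pot.
by lia.
Qed.

(** * Transfer to graphs on ordinals: tree axioms and diameter *)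

Section IndexedGraph.
Variable t : rtree.
Definition tree_rel : rel 'I_#|vert t| :=
  fun i j => adj (enum_val i) (enum_val j).

Lemma dist_leE (x y : vert t) k :
  dist_le tree_rel (enum_rank x) (enum_rank y) k <-> reach x y k.
Proof.
split=> -[p [hp hl hs]].
- exists (map enum_val p); split; last by rewrite size_map.
  + by rewrite -{1}(enum_rankK x) path_map.
  + by rewrite -{1}(enum_rankK x) last_map hl enum_rankK.
- exists (map enum_rank p); split; last by rewrite size_map.
  + rewrite path_map (eq_path (e' := @adj t)) // => a b.
    by rewrite /tree_rel /= !enum_rankK.
  + by rewrite last_map hl.
Qed.

(** The two neighbours on a cycle of a deepest vertex [w] are both shallower than [w], since depth
    changes along every edge. By [parent_unique] they coincide. *)
Lemma adj_acyclic (c : seq (vert t)) :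
  3 <= size c -> uniq c -> ~~ cycle (@adj t) c.
Proof.
move=> hs hu; apply/negP => hc.
have [w wc wmax] : exists2 w, w \in c & forall v, v \in c -> depth v <= depth w.
  case: c hs {hu hc} => // a c _.
  have [w wP wmax] := @arg_maxnP _ a (fun x => x \in a :: c) (@depth t) (mem_head _ _).
  by exists w.
have [i c' hrot] := rot_to wc.
have hsz : size (w :: c') = size c by rewrite -hrot size_rot.
have hu' : uniq (w :: c') by rewrite -hrot rot_uniq.
have hc' : cycle (@adj t) (w :: c') by rewrite -hrot rot_cycle.
have hmem v : v \in c' -> depth v <= depth w.
  by move=> hv; apply: wmax; rewrite -(mem_rot i) hrot inE hv orbT.
have lower v : v \in c' -> adj w v -> depth v < depth w.
  by move=> /hmem h /depth_adj; lia.
case: c' {hrot} hsz hu' hc' hmem lower => [|x [|z r]]; try by move=> h; move: hs; rewrite -h.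
move=> _ hu' hc' _ lower.
set l := last z r.
have lr : l \in z :: r by exact: mem_last.
move: hc' => /=; rewrite rcons_path => /and3P[hwx _ /andP[_]].
rewrite -/l adj_sym => hwl.
have xl : x = l.
  apply: (@parent_unique t w) => //; apply: lower => //; first exact: mem_head.
  by rewrite inE lr orbT.
by move: hu' => /and3P[_]; rewrite xl lr.
Qed.

Lemma tree_rel_is_tree : is_tree tree_rel.
Proof.
split; first by apply/card_gt0P; exists (root t).
split; first by split=> [x y|x]; rewrite /tree_rel ?adj_irrefl // adj_sym.
split.
- move=> x y; rewrite -[x]enum_valK -[y]enum_valK; apply/connectP.
  have /dist_leE[p [hp hl _]] := reach_le (enum_val x) (enum_val y).
  by exists p.
- move=> c hs hu; have := @adj_acyclic (map enum_val c).
  by rewrite size_map map_inj_uniq ?cycle_map; [exact | exact: enum_val_inj].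
Qed.

End IndexedGraph.

Lemma tree_rel_diameter T U n : height T = n -> height U = n ->
  has_diameter (@tree_rel (Graft T U)) (2 * n + 1).
Proof.
move=> hT hU; split.
- move=> x y; rewrite -[x]enum_valK -[y]enum_valK; apply/dist_leE.
  by apply: reach_graft_le; rewrite ?hT ?hU.
- have [a ha] := height_attained T; have [b hb] := height_attained U.
  exists (enum_rank (inl a : vert (Graft T U))).
  exists (enum_rank (inr b : vert (Graft T U))).
  by move=> k /dist_leE /reach_graft_ge; rewrite ha hb hT hU; lia.
Qed.

(** * Eigenvector equations on rooted trees *)

Local Open Scope ring_scope.

(* z is the value of the extra parent of the root. *)
Definition eigen_eq t (l : algC) (y : vert t -> algC) (z : algC) : Prop :=
  forall w, \sum_x (adj x w)%:R * y x + (w == root t)%:R * z = l * y w.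

(** The second clause is what lets a nonzero [D] exclude eigenvectors: with [z = 0] the root value
    vanishes, and then so does everything else. *)
Definition resolves t (l D : algC) : Prop :=
  forall y z, eigen_eq l y z ->
    D * y (root t) = z /\ (y (root t) = 0 -> forall w, y w = 0).

Lemma resolves_Vtx l : resolves Vtx l l.
Proof.
move=> y z /(_ tt) /=.
under eq_bigr do rewrite mul0r.
rewrite big1 // add0r mul1r => ->; split=> // h [].
exact: h.
Qed.

Lemma sum_pick t (y : vert t -> algC) (b : bool) :
  \sum_x ((x == root t) && b)%:R * y x = b%:R * y (root t).
Proof.
rewrite (bigD1 (root t)) //= eqxx big1 ?addr0 // => x /negbTE->.
by rewrite mul0r.
Qed.

(** The root of [T] is the extra parent of [U], so [y (root U) = y (root T) / DU]. On [T], this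
    value is added to that of the extra parent. *)
Lemma resolves_Graft T U l DT DU : DU != 0 -> resolves T l DT ->
  resolves U l DU -> resolves (Graft T U) l (DT - DU^-1).
Proof.
move=> DU0 hT hU y z hy.
have eU : eigen_eq l (fun x : vert U => y (inr x)) (y (inl (root T))).
  move=> w; rewrite -(hy (inr w)) big_sumType /= mul0r addr0 addrC.
  by rewrite (sum_pick (fun x => y (inl x))).
have eT : eigen_eq l (fun x : vert T => y (inl x)) (z + y (inr (root U))).
  move=> w; rewrite -(hy (inl w)) big_sumType /= mulrDr.
  under [X in _ = _ + X + _]eq_bigr do rewrite andbC.
  rewrite (sum_pick (fun x => y (inr x))).
  by rewrite addrA addrAC.
have [hT1 hT2] := hT _ _ eT; have [hU1 hU2] := hU _ _ eU.
have yU : y (inr (root U)) = DU^-1 * y (inl (root T)).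
  by rewrite -hU1 mulKf.
split=> /=; first by rewrite mulrBl hT1 -yU addrK.
move=> h; have h' := h; move=> [x|x]; first exact: hT2.
by apply: hU2; rewrite yU h' mulr0.
Qed.

Lemma tree_rel_eigenvalue t a D :
  eigenvalue (adj_mx (@tree_rel t)) a -> resolves t a D -> D = 0.
Proof.
move=> /eigenvalueP[v va v0] hD; apply/eqP; apply: contraR v0 => D0.
pose y (w : vert t) := v 0 (enum_rank w).
have ey : eigen_eq a y 0.
  move=> w; rewrite mulr0 addr0.
  have /matrixP/(_ 0 (enum_rank w)) := va; rewrite !mxE => <-.
  rewrite (reindex (@enum_val _ (vert t))) /=; last first.
    by exists enum_rank => x _; rewrite ?enum_valK ?enum_rankK.
  apply: eq_bigr => i _; rewrite !mxE /tree_rel enum_rankK /y enum_valK.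
  by rewrite mulrC.
have [h1 h2] := hD _ _ ey.
have /h2 h3 : y (root t) = 0.
  by move/eqP: h1; rewrite mulf_eq0 (negbTE D0) => /eqP.
apply/eqP/rowP => i; rewrite mxE -[i]enum_valK; exact: h3.
Qed.

(** * Repeated grafting and Csikvari's trees *)

Definition graftn (m : nat) (T U : rtree) := iter m (fun V => Graft V U) T.

Lemma height_graftn m T U : (0 < m)%N ->
  height (graftn m T U) = maxn (height T) (height U).+1.
Proof.
case: m => // m _; elim: m => [|m IH] //.
rewrite -[LHS]/(maxn (height (graftn m.+1 T U)) (height U).+1) IH.
by rewrite -maxnA maxnn.
Qed.

Lemma card_graftn m T U : (m <= #|vert (graftn m T U)|)%N.
Proof.
elim: m => // m IH; rewrite /graftn iterS -/(graftn _ _ _) /= card_sum.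
have : (0 < #|vert U|)%N by apply/card_gt0P; exists (root U).
lia.
Qed.

Lemma resolves_graftn m T U l DT DU : DU != 0 -> resolves T l DT ->
  resolves U l DU -> resolves (graftn m T U) l (DT - m%:R / DU).
Proof.
move=> DU0 hT hU; elim: m => [|m IH]; first by rewrite mul0r subr0.
rewrite /graftn iterS -/(graftn _ _ _).
have := resolves_Graft DU0 IH hU.
by rewrite -addrA -opprD -natr1 mulrDl mul1r.
Qed.

(* The value s 0 should be 0, and C_(-1) is taken to be the single vertex. *)
Fixpoint csik (s : nat -> nat) (k : nat) : rtree :=
  if k is k1.+1 then
    graftn (s k - s k1) (if k1 is k2.+1 then csik s k2 else Vtx) (csik s k1)
  else Vtx.

(** The convention D_(-1) = l makes D_k D_(k-1) = l^2 - s_k true already at k = 0, because s_0 =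
    0. *)
Fixpoint csikD (s : nat -> nat) (l : algC) (k : nat) : algC :=
  if k is k1.+1 then
    (if k1 is k2.+1 then csikD s l k2 else l) - (s k - s k1)%:R / csikD s l k1
  else l.

Section Csikvari.
Variables (s : nat -> nat) (l : algC).
Hypotheses (s0 : s 0%N = 0%N) (s_lt : forall k, (s k < s k.+1)%N).

Lemma csikSS k :
  csik s k.+2 = graftn (s k.+2 - s k.+1) (csik s k) (csik s k.+1).
Proof. by []. Qed.

Lemma csikDSS k :
  csikD s l k.+2 = csikD s l k - (s k.+2 - s k.+1)%:R / csikD s l k.+1.
Proof. by []. Qed.

Lemma height_csik k : height (csik s k) = k.
Proof.
suff: height (csik s k) = k /\ height (csik s k.+1) = k.+1 by case.
have gt0 j : (0 < s j.+1 - s j)%N by rewrite subn_gt0.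
elim: k => [|k [IH1 IH2]].
  by split=> //; rewrite /csik height_graftn.
by split=> //; rewrite csikSS height_graftn // IH1 IH2; lia.
Qed.

Hypothesis ls : forall k, l ^+ 2 != (s k)%:R.

(** The facts support each other: the product identity and [ls] give D_(k+1) != 0, which permits the
    next grafting, and multiplying the recursion by D_(k+1) gives the next product. *)
Lemma csikD_rec k :
  [/\ csikD s l k != 0,
      csikD s l k.+1 * csikD s l k = l ^+ 2 - (s k.+1)%:R,
      resolves (csik s k) l (csikD s l k) &
      resolves (csik s k.+1) l (csikD s l k.+1)].
Proof.
elim: k => [|k [D0 DD r0 r1]].
  have l0 : l != 0.
    by apply: contraNneq (ls 0%N) => ->; rewrite s0 expr0n.
  split=> //.
  - by rewrite /= s0 subn0; field.
  - exact: resolves_Vtx.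
  - by apply: (@resolves_graftn (s 1 - s 0) _ _ _ _ _ l0); exact: resolves_Vtx.
have D1 : csikD s l k.+1 != 0.
  apply: contraNneq (ls k.+1) => e.
  by move: DD; rewrite e mul0r => /esym/eqP; rewrite subr_eq0.
split=> //.
- rewrite csikDSS mulrBl mulrC DD mulfVK // natrB; first ring.
  exact: ltnW.
- by rewrite csikSS csikDSS; apply: resolves_graftn.
Qed.

Lemma csikD_neq0 k : csikD s l k != 0.
Proof. by case: (csikD_rec k). Qed.

Lemma csikD_mul k : csikD s l k.+1 * csikD s l k = l ^+ 2 - (s k.+1)%:R.
Proof. by case: (csikD_rec k). Qed.

Lemma csik_resolves k : resolves (csik s k) l (csikD s l k).
Proof. by case: (csikD_rec k). Qed.

End Csikvari.

(** The squares with the first [a] positive ones dropped, index 0 keeping the value 0 that [csik]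
    expects. *)
Definition sq (a i : nat) : nat := if i is 0 then 0 else (a + i) ^ 2.

Lemma sq_lt a k : (sq a k < sq a k.+1)%N.
Proof. by case: k => [|k]; rewrite /sq; nia. Qed.

(** * Dropping the first parameter when all parameters are squares *)

Section Squares.
Variable l : algC.
Hypothesis hl : forall k : nat, l ^+ 2 != (k ^ 2)%:R.

Lemma sq_neq a k : l ^+ 2 != (sq a k)%:R.
Proof. by case: k => [|k]; [exact: (hl 0) | exact: hl]. Qed.

Let D a k := csikD (sq a) l k.
Let D_neq0 a k : D a k != 0 := csikD_neq0 (erefl : sq a 0 = 0) (sq_lt a) (sq_neq a) k.
Let D_mul a k : D a k.+1 * D a k = l ^+ 2 - (sq a k.+1)%:R :=
  csikD_mul (erefl : sq a 0 = 0) (sq_lt a) (sq_neq a) k.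

(** Products of consecutive terms agree on both sides, so the ratio of [D a k.+1] to [D a.+1 k] is
    inverted whenever [k] grows by one. At k = 0 it is (l^2 - s_1) / l^2. *)
Lemma csikD_shift a k :
  D a k.+1 * (if odd k then l ^+ 2 - (sq a 1)%:R else l ^+ 2) =
  (if odd k then l ^+ 2 else l ^+ 2 - (sq a 1)%:R) * D a.+1 k.
Proof.
elim: k => [|k IH]; first by rewrite -D_mul /D /=; ring.
have shift : D a k.+2 * D a k.+1 = D a.+1 k.+1 * D a.+1 k.
  by rewrite !D_mul /sq addnS addSn.
apply: (mulIf (mulf_neq0 (D_neq0 a k.+1) (D_neq0 a.+1 k))).
rewrite oddS; case: (odd k) IH => IH; rewrite ?[~~ _]/=.
- transitivity (D a k.+2 * D a k.+1 * (l ^+ 2 * D a.+1 k)); first ring.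
  by rewrite -IH shift; ring.
- transitivity (D a k.+2 * D a k.+1 * ((l ^+ 2 - (sq a 1)%:R) * D a.+1 k)).
    by ring.
  by rewrite -IH shift; ring.
Qed.

(* 1 / D_n(s_1, s_2, ...) is affine in s_1; at s_1 = 0 and s_1 = s_2 it becomes
   1 / D_(n-1)(s_2, ...) and 1 / D_(n-2)(s_3, ...) respectively. *)
Lemma csikD_convex k : ~~ odd k ->
  4 / D 0 k.+2 = 3 / D 1 k.+1 + 1 / D 2 k.
Proof.
move=> /negbTE ek.
have := csikD_shift 0 k.+1; rewrite /= ek /= => e1.
have := csikD_shift 1 k; rewrite ek => e2.
have n1 : l ^+ 2 - 1 != 0 by rewrite subr_eq0; exact: (hl 1).
have n4 : l ^+ 2 - 4 != 0 by rewrite subr_eq0; exact: (hl 2).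
have n0 : l ^+ 2 != 0 by exact: (hl 0).
have f1 : D 1 k.+1 = D 0 k.+2 * (l ^+ 2 - 1) / l ^+ 2 by rewrite e1 [l ^+ 2 * _]mulrC mulfK.
have f2 : D 2 k = D 0 k.+2 * (l ^+ 2 - 1) / (l ^+ 2 - 4).
  rewrite -[D 2 k](mulKf n4) -e2 f1; field.
  by rewrite n4; move: n0; rewrite expf_eq0.
(* Over the common denominator this is 3 l^2 + (l^2 - 4) = 4 (l^2 - 1). *)
rewrite f1 f2; field.
rewrite n1 D_neq0 n4 /=.
by move: n0; rewrite expf_eq0.
Qed.

End Squares.

(** * The trees of diameter 2n + 1 *)

(* Here n = 2 h + 2, s_2 - s_1 = 3 and s_1 = 1. *)
Definition half_tree (h q : nat) : rtree :=
  graftn q (graftn (3 * q) (csik (sq 0) (2 * h).+1) (csik (sq 1) (2 * h).+1))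
    (csik (sq 2) (2 * h)).

Lemma height_half_tree h q : (0 < q)%N ->
  height (half_tree h q) = (2 * h).+2.
Proof.
move=> q0; have q3 : (0 < 3 * q)%N by rewrite muln_gt0.
have hc a k : height (csik (sq a) k) = k by apply: height_csik => //; exact: sq_lt.
by rewrite /half_tree (height_graftn _ _ q0) (height_graftn _ _ q3) !hc; lia.
Qed.

(** By [csikD_convex] times [q], the shorter branches contribute as much as 4q copies of C_n, which
    would have made the height n + 1. *)
Lemma half_tree_resolves h q l : (forall k : nat, l ^+ 2 != (k ^ 2)%:R) ->
  resolves (half_tree h q) l
    (csikD (sq 0) l (2 * h).+1 - (4 * q)%:R / csikD (sq 0) l (2 * h).+2).
Proof.
move=> hl.
have r a := csik_resolves (erefl : sq a 0 = 0) (sq_lt a) (sq_neq hl a).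
have n a := csikD_neq0 (erefl : sq a 0 = 0) (sq_lt a) (sq_neq hl a).
have -> : (4 * q)%:R / csikD (sq 0) l (2 * h).+2 =
    (3 * q)%:R / csikD (sq 1) l (2 * h).+1 + q%:R / csikD (sq 2) l (2 * h).
  have even2h : ~~ odd (2 * h) by rewrite mul2n odd_double.
  have := congr1 ( *%R q%:R) (csikD_convex hl even2h).
  by rewrite mulrDr !mulrA mulr1 !natrM ![q%:R * _]mulrC.
by rewrite opprD addrA; apply: resolves_graftn => //; apply: resolves_graftn.
Qed.

Lemma int_of_sqr (l : algC) (k : nat) : l ^+ 2 = (k ^ 2)%:R -> l \is a Num.int.
Proof.
rewrite natrX => /eqP; rewrite eqf_sqr => /orP[] /eqP->; rewrite ?rpredN;
  exact: intr_nat.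
Qed.

Lemma half_tree_integral h q x : ((2 * h).+2 ^ 2 + 4 * q + 1 = x ^ 2)%N ->
  integral_graph (@tree_rel (Graft (half_tree h q) (csik (sq 0) (2 * h).+2))).
Proof.
move=> hx l ev; apply: contraT => notint.
have hl k : l ^+ 2 != (k ^ 2)%:R by apply: contra notint => /eqP /int_of_sqr.
have r := @csik_resolves _ _ (erefl : sq 0 0 = 0) (sq_lt 0) (sq_neq hl 0) (2 * h).+2.
have D0 := csikD_neq0 (erefl : sq 0 0 = 0) (sq_lt 0) (sq_neq hl 0) (2 * h).+2.
have DD := csikD_mul (erefl : sq 0 0 = 0) (sq_lt 0) (sq_neq hl 0) (2 * h).+1.
have := tree_rel_eigenvalue ev (resolves_Graft D0 (@half_tree_resolves h q l hl) r).
move: D0 DD.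
move: (csikD _ _ _) (csikD _ _ _) => B A A0 AB e.
(* Multiplying by [A] = D_n leaves l^2 - n^2 - 4q - 1, that is l^2 - x^2. *)
have {}e : A * B - (4 * q)%:R - 1 = 0.
  by have := congr1 ( *%R A) e; rewrite mulr0 => <-; field.
have /negP[] := hl x; rewrite -hx -subr_eq0 !natrD.
by apply/eqP; rewrite -{}e AB /sq; ring.
Qed.

Local Close Scope ring_scope.

Theorem theorem5 (n : nat) : 0 < n -> ~~ odd n ->
  forall m : nat, exists (N : nat) (e : rel 'I_N),
    [/\ m <= N, is_tree e, has_diameter e (2 * n + 1) & integral_graph e].
Proof.
move=> n0 en m.
have [h ->] : exists h, n = (2 * h).+2 by exists n./2.-1; lia.
(* Solves n^2 + 4q + 1 = x^2 for x = n + 2m + 1. Also q >= m makes the tree large, and the summand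
   [h.+1] keeps q positive. *)
pose q := 2 * (h.+1 * m) + m * m + h.+1 + m.
exists _, (@tree_rel (Graft (half_tree h q) (csik (sq 0) (2 * h).+2))); split.
- rewrite card_sum; apply: leq_trans (leq_addr _ _).
  apply: leq_trans (card_graftn _ _ _); exact: leq_addl.
- exact: tree_rel_is_tree.
- apply: tree_rel_diameter; first by apply: height_half_tree; rewrite /q addnS.
  by apply: height_csik => //; exact: sq_lt.
- by apply: (@half_tree_integral _ _ (2 * (h.+1 + m) + 1)); rewrite /q -!mulnn; lia.
Qed.
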